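(* Let $(X,d)$ be a controlled metric type space with control function $\alpha : X\times X\to[1,\infty)$, let $r\ge 0$ be a real number, and let $\{x_n\}_{n\in\mathbb N}$ be a sequence in $X$. If $\sup_{x,y\in X}\alpha(x,y)$ exists (is finite) and equals $k$, then $(LIM^{r}x_n)'\subseteq LIM^{rk}x_n$, where $(LIM^{r}x_n)'$ denotes the set of all limit points of $LIM^{r}x_n$.
   Context: A controlled metric type space is a nonempty set $X$ with functions $\alpha: X\times X\to[1,\infty)$ and $d:X\times X\to[0,\infty)$ such that for all $x,y,z\in X$: $d(x,y)=0$ iff $x=y$; $d(x,y)=d(y,x)$; and $d(x,y)\le \alpha(x,z)d(x,z)+\alpha(z,y)d(z,y)$. (No symmetry of $\alpha$ is assumed.) For a real $\rho\ge0$, a sequence $\{x_n\}$ in $X$ is $\rho$-convergent (rough convergent of roughness degree $\rho$) to $x\in X$ if for every $\varepsilon>0$ there is $n_0\in\mathbb N$ with $d(x_n,x)<\rho+\varepsilon$ for all $n\ge n_0$. The $\rho$-limit set $LIM^{\rho}x_n$ is the set of all $x\in X$ to which $\{x_n\}$ is $\rho$-convergent. Open balls are $B(y,\varepsilon)=\{z\in X: d(y,z)<\varepsilon\}$. A point $y\in X$ is a limit point of $A\subseteq X$ if for every $\varepsilon>0$ the ball $B(y,\varepsilon)$ contains a point of $A$ different from $y$. *)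

(* Defs.v *)
From HB Require Import structures.
From mathcomp Require Import all_boot all_order all_algebra.
From mathcomp Require Import all_classical all_reals.

Set Implicit Arguments.
Unset Strict Implicit.
Unset Printing Implicit Defensive.

Import Order.TTheory GRing.Theory Num.Theory.

Local Open Scope classical_set_scope.
Local Open Scope ring_scope.

(* The control function [alpha] is not assumed symmetric, so the order of its
   arguments in [cm_triangle] matters. *)
Record controlled_metric (R : realType) (X : Type) (alpha d : X -> X -> R) :
    Prop := ControlledMetric {
  cm_nonempty : [set: X] !=set0;
  cm_alpha_ge1 : forall x y, 1 <= alpha x y;
  cm_ge0 : forall x y, 0 <= d x y;
  cm_eq0 : forall x y, d x y = 0 <-> x = y;
  cm_sym : forall x y, d x y = d y x;
  cm_triangle : forall x y z,
    d x y <= alpha x z * d x z + alpha z y * d z y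
}.

Definition rough_cvg (R : realType) (X : Type) (d : X -> X -> R) (rho : R)
    (u : nat -> X) (x : X) : Prop :=
  forall e : R, 0 < e ->
    exists n0 : nat, forall n : nat, (n0 <= n)%N -> d (u n) x < rho + e.

Definition rough_lim (R : realType) (X : Type) (d : X -> X -> R) (rho : R)
    (u : nat -> X) : set X :=
  [set x | rough_cvg d rho u x].

Definition cm_ball (R : realType) (X : Type) (d : X -> X -> R) (y : X)
    (e : R) : set X :=
  [set z | d y z < e].

(* The library's [limit_point] requires a topology on [X]; here limit points
   are defined directly by the open balls of [d]. *)
Definition limit_points (R : realType) (X : Type) (d : X -> X -> R)
    (A : set X) : set X :=
  [set y | forall e : R, 0 < e -> exists z : X,
     [/\ cm_ball d y e z, A z & z <> y]].

(* Main.v *)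
Require Import Defs.
From mathcomp Require Import all_boot all_order all_algebra.
From mathcomp Require Import all_classical all_reals.
From mathcomp Require Import ring.

Import Order.TTheory GRing.Theory Num.Theory.

Local Open Scope classical_set_scope.
Local Open Scope ring_scope.

(** A limit point [y] has points [z] of the [r]-limit set arbitrarily near it. The triangle
    inequality through [z], with both control factors at most [k], bounds [d (u n) y] by [k] times
    [d (u n) z + d z y]. *)

Theorem theorem3p8 (R : realType) (X : Type) (alpha d : X -> X -> R)
    (hX : controlled_metric alpha d) (r : R) (hr : 0 <= r) (u : nat -> X)
    (k : R)
    (hsup : has_sup [set alpha p.1 p.2 | p in [set: X * X]])
    (hk : sup [set alpha p.1 p.2 | p in [set: X * X]] = k) :
  limit_points d (rough_lim d r u) `<=` rough_lim d (r * k) u.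
Proof.
move=> y hy e e_gt0.
have alpha_le a b : alpha a b <= k.
  by rewrite -hk; apply: (ub_le_sup hsup.2); exists (a, b).
have k_gt0 : 0 < k.
  exact: lt_le_trans ltr01 (le_trans (cm_alpha_ge1 hX y y) (alpha_le y y)).
(* Two errors, the radius around [y] and the slack in the rough convergence to [z], are each scaled
   by [k]; this choice makes them total [e]. *)
have e'_gt0 : 0 < e / (2 * k) by rewrite divr_gt0 ?mulr_gt0.
have [z [dyz /(_ _ e'_gt0)[n0 hn0] _]] := hy _ e'_gt0.
exists n0 => n /hn0 dunz.
have -> : r * k + e = k * (r + e / (2 * k)) + k * (e / (2 * k)).
  by field; rewrite gt_eqF.
apply: (le_lt_trans (cm_triangle hX (u n) y z)).
have term_lt a b c : d a b < c -> alpha a b * d a b < k * c.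
  move=> dab; apply: (@le_lt_trans _ _ (k * d a b)).
    by rewrite ler_wpM2r ?(cm_ge0 hX).
  by rewrite ltr_pM2l.
(* Symmetry turns the ball bound on [d y z] into the bound on [d z y]. *)
by apply: ltrD; apply: term_lt; rewrite // (cm_sym hX).
Qed.
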